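(* Let $k\ge 3$ and $s\geq k+3$ be integers, and let $\eta$ be a positive number. Then there exists a positive number $\gamma$ such that for all $A\ge 1$, $$\#\{\mathbf{a}\in(\mathbb{Z}\setminus\{0\})^s: |\mathbf{a}|\leq A,\ 0<\mathfrak{S}_{\mathbf{a}}<A^{-\eta}\}\ll A^{s-\gamma},$$ the implicit constant depending only on $k,s,\eta$.
   Context: $|\mathbf{a}|=\max_j|a_j|$. For $\mathbf{a}=(a_1,\dots,a_s)$ with non-zero integer entries and a prime $p$, $\chi_p(\mathbf{a})=\lim_{h\to\infty}p^{h(1-s)}\#\{1\le x_j\le p^h\ (1\le j\le s): a_1x_1^k+\dots+a_sx_s^k\equiv 0 \pmod{p^h}\}$ (these limits exist), and $\mathfrak{S}_{\mathbf{a}}=\prod_p\chi_p(\mathbf{a})$ (a convergent product). *)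

(* Defs.v *)
From HB Require Import structures.
From mathcomp Require Import all_boot all_order all_algebra.
From mathcomp Require Import all_classical all_reals all_analysis.
Set Implicit Arguments. Unset Strict Implicit. Unset Printing Implicit Defensive.
Import Order.TTheory GRing.Theory Num.Theory.
Import numFieldNormedType.Exports.
Local Open Scope ring_scope.

(* #{1 <= x_j <= p^h : a_1 x_1^k + ... + a_s x_s^k == 0 mod p^h}; x_j is
   represented by (i_j + 1) with i_j : 'I_(p^h). *)
Definition Nsol (k : nat) (a : seq int) (p h : nat) : nat :=
  #|[set x : {ffun 'I_(size a) -> 'I_(p ^ h)} |
      ((p ^ h)%:Z %| \sum_(j < size a) a`_j * ((x j).+1)%:Z ^+ k)%Z]|.

Definition chi (R : realType) (k : nat) (p : nat) (a : seq int) : R :=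
  limn (fun h : nat =>
    (p%:R : R) ^ ((h%:Z) * (1 - (size a)%:Z)) * (Nsol k a p h)%:R).

Definition singser (R : realType) (k : nat) (a : seq int) : R :=
  limn (fun N : nat => \prod_(p < N | prime p) chi R k p a).

Fixpoint box (n B : nat) : seq (seq int) :=
  match n with
  | 0 => [:: [::]]
  | n'.+1 => [seq x :: t | x <- [seq (i%:Z - B%:Z) | i <- iota 0 (B + B).+1],
                           t <- box n' B]
  end.

Definition bad_count (R : realType) (k s : nat) (eta A : R) : nat :=
  count (fun a : seq int =>
           [&& all (fun x => x != 0) a,
               all (fun x => (`|x|%:~R : R) <= A) a,
               0 < singser R k a &
               singser R k a < A `^ (- eta)])
        (box s (Num.truncn A)).

(* Main.v *)
Require Import Defs.
From HB Require Import structures.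
From mathcomp Require Import all_boot all_order all_algebra all_field.
From mathcomp Require Import all_classical all_reals all_analysis.
From mathcomp Require Import zify ring lra.
Import Order.TTheory GRing.Theory Num.Theory.
Import numFieldNormedType.Exports.
Local Open Scope ring_scope.

(** Each factor of the singular series is bounded below separately. If p > P0
    divides at most one coefficient, exponential sums over F_p and Hensel's lemma
    give chi_p >= 1 - C p^(-3/2) (at least five coefficients are units), so these
    primes contribute at least 1/2 in total. For every other prime, chi_p > 0
    forces a primitive solution modulo p^(2w+1), where w = v_p(k a_1 ... a_s):
    otherwise all solutions modulo p^h come by scaling from solutions modulo
    p^(h-k), and as s > k the density would vanish. Hensel's lemma then gives
    chi_p >= p^(-(s-1)(2w+1)). The bad primes beyond P0 divide some gcd(a_i, a_j),
    and p^v <= p (p^[v/2])^2, so the product of these bounds is at least c T^(-E)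
    when all gcds of two coefficients and all d with d^2 | a_j are at most T. The
    remaining coefficient vectors number O(A^s / T), and T is taken to be a small
    power of A. *)

Set Implicit Arguments.
Unset Strict Implicit.
Unset Printing Implicit Defensive.

(** * Hensel lifting *)

Lemma exprD_taylor2 (R : comPzRingType) (x y : R) (k : nat) :
  exists r, (x + y) ^+ k = x ^+ k + k%:R * x ^+ k.-1 * y + r * y ^+ 2.
Proof.
elim: k => [|k [r Hr]]; first by exists 0; rewrite !expr0; ring.
case: k Hr => [|k] Hr; first by exists 0; rewrite !expr1 expr0; ring.
exists (r * (x + y) + k.+1%:R * x ^+ k).
rewrite exprS Hr /= !exprS -[k.+2%:R]natr1; ring.
Qed.

Lemma pow_factor (p : nat) (w : nat) (D : int) : prime p ->
  ~~ (p%:Z ^+ w.+1 %| D)%Z ->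
  exists w' D', [/\ (w' <= w)%N, D = p%:Z ^+ w' * D' & ~~ (p%:Z %| D')%Z].
Proof.
move=> pp; elim: w D => [|w IH] D.
  by rewrite expr1 => h; exists 0, D; rewrite expr0 mul1r.
case: (boolP (p%:Z %| D)%Z) => [/dvdzP [q ->]|pD]; last first.
  by exists 0, D; rewrite expr0 mul1r.
rewrite exprSr dvdz_mul2r; last by rewrite eqz_nat -lt0n prime_gt0.
case/IH => w' [D' [le -> nd]].
by exists w'.+1, D'; split=> //; rewrite exprSr; ring.
Qed.

(** Newton's correction: write the derivative as p^w' D' with p not dividing D', and move x by
    -p^(m-w') q u, where q is the error divided by p^m and u inverts D' modulo p. The quadratic
    remainder is divisible by p^(2(m-w')), which suffices as m >= 2w+1. *)
Lemma hensel_step (p k w m : nat) (b n x : int) : prime p ->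
  ~~ (p%:Z ^+ w.+1 %| k%:Z * b * x ^+ k.-1)%Z -> (w.*2.+1 <= m)%N ->
  (p%:Z ^+ m %| b * x ^+ k - n)%Z ->
  exists y, (p%:Z ^+ w.+1 %| y - x)%Z /\ (p%:Z ^+ m.+1 %| b * y ^+ k - n)%Z.
Proof.
move=> pp nd wm /dvdzP [q Hq].
have [w' [D' [w'w HD nD]]] := pow_factor pp nd.
have cop : coprimez D' p%:Z.
  by rewrite coprimez_sym /coprimez /coprimez /gcdz /= (eqP (_ : coprime p `|D'|)) // prime_coprime // -dvdzE.
have [[u v] /= Huv] := coprimezP _ _ cop.
pose y := p%:Z ^+ (m - w') * (- q * u).
have [r Hr] := exprD_taylor2 x y k.
exists (x + y); split.
  rewrite addrC addKr /y dvdz_mulr //; apply: dvdz_exp2l; move: w'w wm; clear; lia.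
have -> : b * (x + y) ^+ k - n = (b * x ^+ k - n) + (k%:Z * b * x ^+ k.-1) * y + b * r * y ^+ 2.
  by rewrite Hr natz; ring.
rewrite Hq HD /y.
have e1 : p%:Z ^+ m = p%:Z ^+ w' * p%:Z ^+ (m - w') by rewrite -exprD; congr (_ ^+ _); move: w'w wm; clear; lia.
have -> : q * p%:Z ^+ m + p%:Z ^+ w' * D' * (p%:Z ^+ (m - w') * (- q * u))
   = p%:Z ^+ m.+1 * (q * v).
  rewrite exprSr e1; transitivity (q * (p%:Z ^+ w' * p%:Z ^+ (m - w')) * (1 - u * D')); first by ring.
  by rewrite -Huv; ring.
apply: rpredD; first exact: dvdz_mulr.
apply: dvdz_mull; rewrite exprMn dvdz_mulr // -exprM; apply: dvdz_exp2l; move: w'w wm; clear; lia.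
Qed.

Lemma hensel (p k w h : nat) (b n x : int) : prime p ->
  ~~ (p%:Z ^+ w.+1 %| k%:Z * b * x ^+ k.-1)%Z -> (w.*2.+1 <= h)%N ->
  (p%:Z ^+ w.*2.+1 %| b * x ^+ k - n)%Z ->
  exists y, (p%:Z ^+ w.+1 %| y - x)%Z /\ (p%:Z ^+ h %| b * y ^+ k - n)%Z.
Proof.
move=> pp nd /subnK <- H0; elim: (h - _)%N => [|d [y [yx Hy]]].
  by exists x; rewrite subrr dvdz0.
(* The corrections are multiples of p^(w+1), so the condition on the derivative survives the
   iteration. *)
have nd' : ~~ (p%:Z ^+ w.+1 %| k%:Z * b * y ^+ k.-1)%Z.
  apply: contra nd => Hd.
  have -> : k%:Z * b * x ^+ k.-1 = k%:Z * b * y ^+ k.-1 - k%:Z * b * (y ^+ k.-1 - x ^+ k.-1).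
    by ring.
  by apply: rpredB => //; apply: dvdz_mull; rewrite subrXX dvdz_mulr.
have le : (w.*2.+1 <= d + w.*2.+1)%N by rewrite leq_addl.
have [y' [y'y Hy']] := hensel_step pp nd' le Hy.
by exists y'; split=> //; have := rpredD y'y yx; rewrite addrA subrK.
Qed.

(** * Solutions of diagonal congruences modulo prime powers *)

Definition diag_form (k : nat) (a : seq int) (x : 'I_(size a) -> int) : int :=
  \sum_(j < size a) a`_j * x j ^+ k.

(** Convertible to the set counted by [Nsol], but phrased through [diag_form], which also accepts
    arbitrary integer vectors. *)
Definition solset (k : nat) (a : seq int) (p h : nat) :=
  [set x : {ffun 'I_(size a) -> 'I_(p ^ h)} |
    ((p ^ h)%:Z %| diag_form k (fun j => (x j).+1%:Z))%Z].

Lemma diag_form_mod (k : nat) (a : seq int) (d : int) (x y : 'I_(size a) -> int) :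
  (forall j, (d %| x j - y j)%Z) -> (d %| diag_form k x)%Z = (d %| diag_form k y)%Z.
Proof.
move=> H.
have D : (d %| diag_form k x - diag_form k y)%Z.
  rewrite /diag_form -sumrB; apply: rpred_sum => j _.
  by rewrite -mulrBr dvdz_mull // subrXX dvdz_mulr.
by rewrite -{1}(subrK (diag_form k y) (diag_form k x)) rpredDl.
Qed.

Lemma residue_exists (m : nat) (y : int) : (0 < m)%N ->
  exists z : 'I_m, (m%:Z %| z.+1%:Z - y)%Z.
Proof.
move=> m0; have mn0 : m%:Z != 0 by rewrite eqz_nat -lt0n.
have lt : (`|((y - 1) %% m%:Z)%Z| < m)%N.
  by have := modz_ge0 (y - 1) mn0; have := @ltz_pmod (y - 1) m%:Z m0; lia.
exists (Ordinal lt) => /=.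
rewrite -addn1 PoszD gez0_abs ?modz_ge0 //.
apply/dvdzP; exists (- ((y - 1) %/ m%:Z)%Z).
by have := divz_eq (y - 1) m%:Z; lia.
Qed.

Lemma ord_eq_mod (m : nat) (i j : 'I_m) : (m%:Z %| i%:Z - j%:Z)%Z -> i = j.
Proof.
move=> H; apply: val_inj => /=; move: H; rewrite -eqz_mod_dvd => /eqP.
by rewrite !modz_nat !modn_small // => -[].
Qed.

(** All coordinates but [j0] move freely by multiples of p^(2w+1); Hensel's lemma in coordinate [j0]
    restores the congruence modulo p^h. Staying congruent to x modulo p^(w+1) lets [chi_ge_nonsing]
    add up the lifts of distinct zeros. *)
Lemma card_solset_near (k : nat) (a : seq int) (p w h : nat)
    (x : 'I_(size a) -> int) (j0 : 'I_(size a)) :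
  prime p -> (p%:Z ^+ w.*2.+1 %| diag_form k x)%Z ->
  ~~ (p%:Z ^+ w.+1 %| k%:Z * a`_j0 * x j0 ^+ k.-1)%Z -> (w.*2.+1 <= h)%N ->
  (p ^ ((h - w.*2.+1) * (size a).-1) <=
    #|[set z in solset k a p h |
        [forall j, (p%:Z ^+ w.+1 %| ((z j).+1%:Z - x j)%R)%Z]]|)%N.
Proof.
move=> pp Hx nd Hh; set S := [set z in _ | _].
set H := w.*2.+1; set e := (h - H)%N.
have ph : (0 < p ^ h)%N by rewrite expn_gt0 prime_gt0.
have pE m : (p ^ m)%N%:Z = p%:Z ^+ m by rewrite -natz natrX natz.
have lift (t : {ffun 'I_(size a) -> 'I_(p ^ e)}) :
    exists z : {ffun 'I_(size a) -> 'I_(p ^ h)}, z \in S /\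
      forall j, j != j0 -> (p%:Z ^+ h %| (z j).+1%:Z - (x j + p%:Z ^+ H * (t j)%:Z))%Z.
  pose y j := x j + p%:Z ^+ H * (t j)%:Z.
  have yx j : (p%:Z ^+ H %| y j - x j)%Z by rewrite addrC addKr dvdz_mulr.
  pose n := - \sum_(j < size a | j != j0) a`_j * y j ^+ k.
  have [|u [ux Hu]] := @hensel p k w h a`_j0 n (x j0) pp nd Hh.
    have -> : a`_j0 * x j0 ^+ k - n =
        diag_form k (fun j => if j == j0 then x j else y j).
      rewrite /diag_form (bigD1 j0) //= eqxx opprK; congr (_ + _).
      by apply: eq_bigr => j /negPf ->.
    rewrite (@diag_form_mod k a _ _ x) // => j.
    by case: eqP => // _; rewrite subrr dvdz0.
  pose y' j := if j == j0 then u else y j.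
  have Hy' : (p%:Z ^+ h %| diag_form k y')%Z.
    move: Hu; congr (_ %| _)%Z.
    rewrite /diag_form [in RHS](bigD1 j0) //= /y' eqxx opprK; congr (_ + _).
    by apply: eq_bigr => j /negPf ->.
  have [z Hz] : exists z : {ffun 'I_(size a) -> 'I_(p ^ h)},
      forall j, (p%:Z ^+ h %| (z j).+1%:Z - y' j)%Z.
    have [f Hf] := fin_all_exists (fun j => residue_exists (y' j) ph).
    by exists (finfun f) => j; rewrite ffunE -pE.
  exists z; split; last by move=> j /negPf jj; have := Hz j; rewrite /y' jj.
  rewrite !inE pE (@diag_form_mod k a _ _ y') // Hy' /=.
  apply/forallP => j.
  have -> : (z j).+1%:Z - x j = ((z j).+1%:Z - y' j) + (y' j - x j) by rewrite addrA subrK.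
  apply: rpredD.
    by apply: dvdz_trans (Hz j); apply: dvdz_exp2l; move: Hh; clear; lia.
  rewrite /y'; case: eqP => [-> //|_].
  by apply: dvdz_trans (yx j); apply: dvdz_exp2l; rewrite /H; clear; lia.
have [g Hg] := fin_all_exists lift.
(* The coordinate of t at j0 is not used by g; keeping it next to g t makes
   the map injective, at the cost of a factor p^e. *)
have inj : injective (fun t => (g t, t j0)).
  move=> t t' [gg tj0]; apply/ffunP => j.
  have [-> //|jj] := eqVneq j j0.
  have [_ /(_ _ jj) H1] := Hg t; have [_ /(_ _ jj) H2] := Hg t'.
  rewrite gg in H1; have := rpredB H2 H1.
  have -> : (g t' j).+1%:Z - (x j + p%:Z ^+ H * t' j) - ((g t' j).+1%:Z - (x j + p%:Z ^+ H * t j))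
    = p%:Z ^+ H * ((t j)%:Z - (t' j)%:Z) by ring.
  have -> : h = (H + e)%N by rewrite subnKC.
  rewrite exprD dvdz_mul2l; last by rewrite expf_neq0 // eqz_nat -lt0n prime_gt0.
  by rewrite -pE => /ord_eq_mod.
have sub : [set (g t, t j0) | t : {ffun 'I_(size a) -> 'I_(p ^ e)}] \subset finset.setX S [set: 'I_(p ^ e)].
  by apply/fintype.subsetP => _ /imsetP [t _ ->]; rewrite finset.in_setX finset.in_setT andbT; case: (Hg t).
have := subset_leq_card sub.
rewrite card_imset // cardsX cardsT !card_ord card_ffun !card_ord.
have pe : (0 < p ^ e)%N by rewrite expn_gt0 prime_gt0.
have s0 : (0 < size a)%N by apply: leq_ltn_trans (ltn_ord j0).
have -> : ((p ^ e) ^ size a = (p ^ e) ^ (size a).-1 * p ^ e)%N.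
  by rewrite -expnSr (prednK s0).
by rewrite leq_pmul2r // -expnM.
Qed.

Lemma dvdz_pow_unit (p w e : nat) (c x : int) : prime p ->
  ~~ (p%:Z %| x)%Z -> (p%:Z ^+ w %| c * x ^+ e)%Z = (p%:Z ^+ w %| c)%Z.
Proof.
move=> pp px; rewrite Gauss_dvdzl //.
rewrite coprimezE !abszX.
by apply: coprimeXl; apply: coprimeXr; rewrite prime_coprime // -dvdzE.
Qed.

(** All coordinates of a solution being divisible by p, division by p gives a solution modulo
    p^(h-k). The quotients live modulo p^(h-1), so each residue modulo p^(h-k) comes from p^(k-1) of
    them. *)
Lemma Nsol_descent (k : nat) (a : seq int) (p H h : nat) :
  prime p -> (0 < k)%N -> (H <= h)%N -> (k <= h)%N ->
  (forall x, (p%:Z ^+ H %| diag_form k x)%Z -> forall j : 'I_(size a), (p%:Z %| x j)%Z) ->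
  (Nsol k a p h <= Nsol k a p (h - k) * (p ^ k.-1) ^ size a)%N.
Proof.
move=> pp k0 Hh kh prim.
have p0 : (0 < p)%N by rewrite prime_gt0.
have pE m : (p ^ m)%N%:Z = p%:Z ^+ m by rewrite -natz natrX natz.
set q := (p ^ (h - k))%N.
have q0 : (0 < q)%N by rewrite expn_gt0 p0.
have ltr (z : 'I_(p ^ h)) : (z %/ p %/ q < p ^ k.-1)%N.
  rewrite ltn_divLR // /q -expnD ltn_divLR // -expnSr.
  by have -> : (k.-1 + (h - k)).+1 = h by move: k0 kh; clear; lia.
pose f (x : {ffun 'I_(size a) -> 'I_(p ^ h)}) :
    {ffun 'I_(size a) -> 'I_q} * {ffun 'I_(size a) -> 'I_(p ^ k.-1)} :=
  ([ffun j => Ordinal (ltn_pmod (x j %/ p) q0)], [ffun j => Ordinal (ltr (x j))]).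
have divp x j : x \in solset k a p h -> exists y, (x j).+1 = (p * y.+1)%N.
  rewrite inE pE => Hx.
  have := prim _ (dvdz_trans (dvdz_exp2l p%:Z Hh) Hx) j.
  rewrite dvdzE /= => /dvdnP [[|y] Hy]; first by rewrite mul0n in Hy.
  by exists y; rewrite mulnC.
(* Index m stands for the coordinate m+1, so dividing the coordinate p(y+1) by p is floor division
   on indices. *)
have divpE m y : m.+1 = (p * y.+1)%N -> (m %/ p = y)%N /\ m = (p * y + p.-1)%N.
  move=> e; have e' : m = (p * y + p.-1)%N by move: e p0; rewrite mulnS; clear; lia.
  split=> //; rewrite e' mulnC divnMDl // divn_small ?addn0 //.
  by rewrite ltn_predL.
have inj : {in solset k a p h &, injective f}.
  move=> x x' Sx Sx' [/ffunP e1 /ffunP e2]; apply/ffunP => j; apply: val_inj => /=.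
  have [y /divpE [dy ->]] := divp x j Sx.
  have [y' /divpE [dy' ->]] := divp x' j Sx'.
  have := congr1 val (e1 j); have := congr1 val (e2 j); rewrite !ffunE /= dy dy' => g2 g1.
  by rewrite (divn_eq y q) (divn_eq y' q) g1 g2.
have sub : [set f x | x in solset k a p h] \subset
    finset.setX (solset k a p (h - k)) [set: {ffun 'I_(size a) -> 'I_(p ^ k.-1)}].
  apply/fintype.subsetP => _ /imsetP [x Sx ->].
  rewrite finset.in_setX finset.in_setT andbT inE /=.
  have Sx' := Sx; rewrite inE pE in Sx'.
  rewrite (@diag_form_mod k a _ _ (fun j => (x j %/ p)%N.+1%:Z)); last first.
    move=> j; rewrite ffunE /=.
    rewrite !intS opprD addrACA subrr add0r -eqz_mod_dvd !modz_nat.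
    by rewrite modn_mod.
  have e : diag_form k (fun j => (x j).+1%:Z) =
           p%:Z ^+ k * diag_form k (fun j => (x j %/ p)%N.+1%:Z).
    rewrite /diag_form mulr_sumr; apply: eq_bigr => j _.
    have [y Hy] := divp x j Sx; have [dy _] := divpE _ _ Hy.
    by rewrite Hy dy PoszM exprMn; ring.
  have eh : p%:Z ^+ h = p%:Z ^+ k * p%:Z ^+ (h - k) by rewrite -exprD subnKC.
  move: Sx'; rewrite e eh dvdz_mul2l -?pE //.
  by rewrite eqz_nat -lt0n expn_gt0 p0.
have := subset_leq_card sub.
by rewrite card_in_imset // cardsX cardsT card_ffun !card_ord.
Qed.

(** * Lower bounds for a single local density *)

Section LocalDensity.
Variables (R : realType) (k : nat) (p : nat) (a : seq int).
Hypothesis pp : prime p.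
Let f (h : nat) : R := (p%:R : R) ^ ((h%:Z) * (1 - (size a)%:Z)) * (Nsol k a p h)%:R.
Let p0 : 0 < p%:R :> R. Proof. by rewrite ltr0n prime_gt0. Qed.

(* The limit of a divergent sequence is the junk value point = 0, so the hypothesis
   0 < singser supplies all the convergence that is needed. *)
Lemma limn_neq0_cvg (u : nat -> R) : limn u != 0 -> cvgn u.
Proof. by apply: contraNP => h; rewrite (dvgP h). Qed.

(** After normalisation the bound reads M p^(-H(s-1)), free of h, and so passes to the limit. In the
    applications M counts the solutions modulo p^H that are lifted. *)
Lemma chi_ge (M H : nat) : chi R k p a != 0 -> (0 < size a)%N ->
  (forall h, (H <= h)%N -> (M * p ^ ((h - H) * (size a).-1) <= Nsol k a p h)%N) ->
  M%:R / p%:R ^+ (H * (size a).-1) <= chi R k p a.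
Proof.
move=> chi0 s0 HN; apply: limr_ge; first exact: (@limn_neq0_cvg f).
exists H => // h /= Hh.
have -> : (p%:R : R) ^ ((h%:Z) * (1 - (size a)%:Z)) = (p%:R ^+ (h * (size a).-1))^-1.
  rewrite exprnN; congr (_ ^ _).
  by case: (size a) s0 => // n _; rewrite PoszM /=; ring.
rewrite -[X in _ / X <= _]/(_ ^+ _) ler_pdivrMr ?exprn_gt0 //.
rewrite -mulrA ler_pdivlMl ?exprn_gt0 //.
rewrite -!natrX -!natrM ler_nat.
have := HN h Hh; rewrite -(leq_pmul2r (m := p ^ (H * (size a).-1))) ?expn_gt0 ?prime_gt0 //.
rewrite -mulnA -expnD -mulnDl subnK // mulnC => /leq_trans; apply.
by rewrite mulnC.
Qed.

(* The limit L satisfies L <= p^(k - s) L. *)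
Lemma chi_descent (H : nat) : (0 < k)%N -> (k < size a)%N ->
  (forall x, (p%:Z ^+ H %| diag_form k x)%Z -> forall j : 'I_(size a), (p%:Z %| x j)%Z) ->
  chi R k p a <= 0.
Proof.
move=> k0 ks prim; have [->//|chi0] := eqVneq (chi R k p a) 0.
have cf : cvgn f by exact: (@limn_neq0_cvg f).
(* The exponent is k(1-s), from the normalisation at h = n+k, plus s(k-1), from [Nsol_descent]. *)
pose c : R := p%:R ^ (k%:Z - (size a)%:Z).
have le : chi R k p a <= c * chi R k p a.
  rewrite /chi -/f.
  have cfk : ((f (n + k)%N) @[n --> \oo] --> limn f)%classic.
    by rewrite (cvg_shiftn k f (nbhs (limn f))).
  have cfc : ((c * f n) @[n --> \oo] --> c * limn f)%classic.
    by apply: cvgM => //; exact: cvg_cst.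
  apply: (ler_cvg_to cfk cfc).
  exists H => // n /= Hn.
  have := @Nsol_descent k a p H (n + k) pp k0 (leq_trans Hn (leq_addr _ _)) (leq_addl _ _) prim.
  rewrite addnK -(ler_nat R) natrM natrX natrX => le.
  rewrite /f.
  apply: le_trans (ler_wpM2l _ le) _; first by rewrite exprz_ge0 // ltW.
  rewrite -exprM mulrA mulrAC exprnP -expfzDr ?gt_eqF // /c mulrA -expfzDr ?gt_eqF //.
  rewrite (_ : _ + _ = (k%:Z - (size a)%:Z + n%:Z * (1 - (size a)%:Z))) //.
  rewrite PoszM PoszD; case: k k0 => // k' _ /=.
  by rewrite intS; ring.
have c1 : c < 1.
  rewrite /c -[X in _ < X](expr0z (p%:R : R)) ltr_eXz2l ?ltr1n ?prime_gt1 //.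
  by rewrite subr_lt0 ltz_nat.
move: le; rewrite -subr_ge0 -{2}(mul1r (chi _ _ _ _)) -mulrBl => le.
rewrite leNgt; apply/negP => gt0; move: le; rewrite leNgt => /negP; apply.
by rewrite pmulr_llt0 // subr_lt0.
Qed.

(** A solution modulo p^(2w+1) with coordinate j prime to p lifts in that coordinate, because
    p^(w+1) does not divide k a_j. If there is none, [chi_descent] contradicts positivity. *)
Lemma chi_ge_bad (w : nat) : (0 < k)%N -> (k < size a)%N -> 0 < chi R k p a ->
  (forall j : 'I_(size a), ~~ (p%:Z ^+ w.+1 %| k%:Z * a`_j)%Z) ->
  (p%:R ^+ (w.*2.+1 * (size a).-1))^-1 <= chi R k p a.
Proof.
move=> k0 ks chi0 nd.
have [[x [j [Hx xj]]]|no] := pselect (exists x (j : 'I_(size a)),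
   (p%:Z ^+ w.*2.+1 %| diag_form k x)%Z /\ ~~ (p%:Z %| x j)%Z).
  rewrite -[leLHS]mul1r; apply: (@chi_ge 1); rewrite ?gt_eqF //.
    by apply: leq_trans ks.
  move=> h Hh; rewrite mul1n.
  apply: leq_trans (@card_solset_near k a p w h x j pp Hx _ Hh) _.
    by rewrite dvdz_pow_unit.
  by apply: subset_leq_card; apply/fintype.subsetP => z; rewrite inE => /andP[].
suff : chi R k p a <= 0 by rewrite leNgt chi0.
apply: (@chi_descent w.*2.+1) => // x Hx j.
by apply/negPn/negP => xj; apply: no; exists x, j.
Qed.

(** As p does not divide k, a zero over F_p with some a_j x_j nonzero has a nonzero partial
    derivative and lifts with w = 0. Distinct zeros have disjoint sets of lifts. *)
Lemma chi_ge_nonsing : ~~ (p %| k)%N -> chi R k p a != 0 -> (0 < size a)%N ->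
  #|[set x : {ffun 'I_(size a) -> 'F_p} |
     (\sum_(j < size a) (a`_j)%:~R * x j ^+ k == 0) &&
     [exists j : 'I_(size a), (a`_j)%:~R * x j != 0]]|%:R / p%:R ^+ (size a).-1 <= chi R k p a.
Proof.
move=> pk chi0 s0; set M := [set x | _].
rewrite -[X in _ / _ ^+ X]mul1n; apply: chi_ge => // h h1.
have chp : p \in [pchar 'F_p] by exact: pchar_Fp.
pose red (z : {ffun 'I_(size a) -> 'I_(p ^ h)}) : {ffun 'I_(size a) -> 'F_p} :=
  [ffun j => (z j).+1%:R].
have -> : Nsol k a p h = (\sum_x \sum_(z in solset k a p h | red z == x) 1)%N.
  by rewrite -(partition_big red predT) // sum1_card.
rewrite (bigID (mem M)) /= -sum_nat_const.
apply: leq_trans (leq_addr _ _); apply: leq_sum => x; rewrite inE => /andP[/eqP Hx /existsP [j xj]].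
rewrite sum1_card.
pose y j : int := (x j : nat)%:Z.
have yE i : (y i)%:~R = x i by rewrite /y -[LHS]/((x i : nat)%:R) natr_Zp.
have Hy : (p%:Z ^+ (0%N).*2.+1 %| diag_form k y)%Z.
  rewrite expr1 (dvdz_pcharf chp) /diag_form rmorph_sum -[X in _ == X]Hx; apply/eqP.
  by apply: eq_bigr => i _; rewrite rmorphM rmorphXn /= yE.
have nd : ~~ (p%:Z ^+ 1%N %| k%:Z * a`_j * y j ^+ k.-1)%Z.
  move: xj; rewrite mulf_eq0 negb_or => /andP [aj xj].
  rewrite expr1 (dvdz_pcharf chp) !rmorphM rmorphXn /= yE mulf_neq0 ?expf_neq0 //.
  by rewrite mulf_neq0 // -[X in X != _]/(k%:R) -(dvdn_pcharf chp).
apply: leq_trans (@card_solset_near k a p 0 h y j pp Hy nd h1) _.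
apply: subset_leq_card; apply/fintype.subsetP => z.
rewrite inE => /andP [zS /forallP zx]; rewrite unfold_in zS /=.
apply/eqP/ffunP => i; rewrite ffunE; apply/eqP; rewrite -subr_eq0 -[X in _ - X]yE.
by have := zx i; rewrite expr1 (dvdz_pcharf chp) rmorphB /=.
Qed.
End LocalDensity.

(** * Diagonal equations over F_p *)

Section ExpSum.
Variables (p k : nat).
Hypotheses (pp : prime p) (k0 : (0 < k)%N).
Variable z : algC.
Hypothesis zP : p.-primitive_root z.

(** An additive character of F_p, valued in [algC] to have absolute values and conjugation. *)
Let e (x : 'F_p) : algC := z ^+ x.

Let eN (n : nat) : e n%:R = z ^+ n.
Proof. by rewrite /e val_Fp_nat // (prim_expr_mod zP). Qed.

Let eD x y : e (x + y) = e x * e y.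
Proof.
by rewrite -[in LHS](natr_Zp x) -[in LHS](natr_Zp y) -natrD eN exprD.
Qed.

Let e0 : e 0 = 1. Proof. by rewrite /e expr0. Qed.

Let e_sum (I : finType) (f : I -> 'F_p) : e (\sum_i f i) = \prod_i e (f i).
Proof. exact: (big_morph e eD e0). Qed.

Let e_norm x : `|e x| = 1.
Proof.
have zn : `|z| = 1.
  apply/eqP; rewrite -(@pexpr_eq1 _ _ p) ?prime_gt0 //.
  by rewrite -normrX (prim_expr_order zP) normr1.
by rewrite normrX zn expr1n.
Qed.

Let e_conj x : (e x)^* = e (- x).
Proof.
rewrite -[RHS]mulr1 -[in RHS](expr1n _ 2) -{1}(e_norm x) normCK mulrA -eD addNr e0 mul1r //.
Qed.

Let e_neq1 x : x != 0 -> e x != 1.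
Proof.
move=> x0; rewrite /e -(prim_order_dvd zP) (dvdn_pcharf (pchar_Fp pp)).
by rewrite natr_Zp.
Qed.

Let sum_e x : \sum_(c : 'F_p) e (c * x) = if x == 0 then p%:R else 0.
Proof.
case: eqP => [->|/eqP x0].
  under eq_bigr do rewrite mulr0 e0.
  by rewrite sumr_const card_Fp.
set S := LHS.
have : e x * S = S.
  rewrite /S mulr_sumr [RHS](reindex_inj (addrI 1)).
  by apply: eq_bigr => c _; rewrite -eD mulrDl mul1r.
move/eqP; rewrite -subr_eq0 -{2}(mul1r S) -mulrBl mulf_eq0 subr_eq0.
by rewrite (negPf (e_neq1 x0)) => /eqP.
Qed.

Lemma card_kth_roots (c : 'F_p) : (#|[set t : 'F_p | t ^+ k == c]| <= k)%N.
Proof.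
have := @max_poly_roots 'F_p ('X^k - c%:P) (enum [set t : 'F_p | t ^+ k == c]).
rewrite -size_poly_eq0 size_XnsubC // => /(_ isT) H.
rewrite cardE -ltnS; apply: H; last exact: enum_uniq.
apply/allP => t; rewrite mem_enum inE => /eqP tk.
by rewrite /root !hornerE tk subrr.
Qed.

Let S c := \sum_(y : 'F_p) e (c * y ^+ k).

(** By orthogonality the second moment is p times the number of pairs with x^k = y^k, and each x has
    at most k partners y. *)
Let S_moment : \sum_c `|S c| ^+ 2 <= (k * p ^ 2)%:R.
Proof.
have -> : \sum_c `|S c| ^+ 2 = (\sum_(x : 'F_p) #|[set y : 'F_p | y ^+ k == x ^+ k]| * p)%:R.
  under eq_bigr => c _.
    rewrite normCK /S rmorph_sum mulr_suml.
    under eq_bigr => x _ do (rewrite mulr_sumr; under eq_bigr => y _ do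
      rewrite /= e_conj -eD -mulrBr).
    over.
  rewrite exchange_big natr_sum; apply: eq_bigr => x _ /=.
  rewrite exchange_big /= -sum1_card big_distrl /= natr_sum.
  rewrite [RHS]big_mkcond; apply: eq_bigr => y _.
  rewrite sum_e subr_eq0 inE mul1n eq_sym; by case: ifP.
rewrite ler_nat; apply: leq_trans (_ : \sum_(x : 'F_p) k * p <= _)%N.
  by apply: leq_sum => x _; rewrite leq_mul2r card_kth_roots orbT.
by rewrite sum_nat_const card_Fp // mulnCA -mulnn leqnn.
Qed.

(* |S(c)| depends only on the class of c modulo k-th powers, and a class has at least
   (p-1)/k elements, so the second moment bounds each individual sum. *)
Let S_bound c : c != 0 -> `|S c| ^+ 2 <= (2 * k ^ 2 * p)%:R.
Proof.
move=> c0.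
have inv t : t != 0 -> S (c * t ^+ k) = S c.
  move=> t0; rewrite /S [RHS](reindex_inj (mulfI t0)).
  by apply: eq_bigr => y _; rewrite exprMn mulrA.
have H1 : \sum_(t : 'F_p | t != 0) `|S (c * t ^+ k)| ^+ 2 = (p.-1)%:R * `|S c| ^+ 2.
  under eq_bigr => t t0 do rewrite inv //.
  by rewrite sumr_const -[#|_|]/#|predC1 (0 : 'F_p)| cardC1 card_Fp // mulr_natl.
have H2 : \sum_(t : 'F_p | t != 0) `|S (c * t ^+ k)| ^+ 2 <= (k ^ 2 * p ^ 2)%:R.
  apply: le_trans (_ : k%:R * \sum_c' `|S c'| ^+ 2 <= _); last first.
    apply: le_trans (ler_wpM2l _ S_moment) _; first exact: ler0n.
    by rewrite -natrM mulnA.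
  rewrite (partition_big (fun t => c * t ^+ k) predT) //= mulr_sumr.
  apply: ler_sum => c' _.
  apply: le_trans (_ : \sum_(t : 'F_p | t ^+ k == c' / c) `|S c'| ^+ 2 <= _).
    rewrite big_mkcond [leRHS]big_mkcond; apply: ler_sum => t _ /=.
    case: eqP => [_|/eqP t0] /=; first by case: ifP => // _; rewrite exprn_ge0.
    case: eqP => [<-|_]; last by case: ifP => // _; rewrite exprn_ge0.
    by rewrite mulrAC mulfV // mul1r eqxx.
  rewrite sumr_const -[leLHS]mulr_natl ler_wpM2r ?exprn_ge0 // ler_nat.
  by have := card_kth_roots (c' / c); rewrite cardsE.
have p1 : (1 < p)%N by apply: prime_gt1.
have pos : 0 < (p.-1)%:R :> algC by rewrite ltr0n; move: p1; clear; lia.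
rewrite -(ler_pM2l pos) -H1; apply: le_trans H2 _.
(* The factor 2 in the bound absorbs p <= 2(p-1). *)
rewrite -natrM ler_nat (_ : (p.-1 * _)%N = (k ^ 2 * (2 * p.-1 * p))%N); last by ring.
rewrite leq_mul2l -mulnn leq_mul2r; apply/orP; right; apply/orP; right.
by move: p1; clear; lia.
Qed.

(** Detecting zeros by characters writes p N as the sum over c of prod_j S(c a_j). The term c = 0 is
    p^s; in the others, the factor at [j0], whose coefficient may vanish, is bounded trivially by p
    and the rest by [S_bound]. *)
Lemma exp_sum_count (s : nat) (a : 'I_s -> 'F_p) (j0 : 'I_s) :
  (forall j, j != j0 -> a j != 0) ->
  `|(#|[set x : {ffun 'I_s -> 'F_p} | \sum_j a j * x j ^+ k == 0]|)%:R - p%:R ^+ s.-1| ^+ 2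
   <= (p ^ 2 * (2 * k ^ 2 * p) ^ s.-1)%:R :> algC.
Proof.
move=> aj; set N := #|_|.
have s0 : (0 < s)%N by apply: leq_ltn_trans (ltn_ord j0).
have p0 : 0 < p%:R :> algC by rewrite ltr0n prime_gt0.
have pN : p%:R * N%:R = \sum_c \prod_j S (c * a j).
  transitivity (\sum_(c : 'F_p) \sum_(x : {ffun 'I_s -> 'F_p}) e (c * \sum_j a j * x j ^+ k)).
    rewrite exchange_big /=.
    under eq_bigr do rewrite sum_e.
    rewrite -big_mkcond sumr_const mulr_natr /N cardsE //.
  apply: eq_bigr => c _; rewrite /S.
  rewrite (bigA_distr_bigA (fun j y => e (c * a j * y ^+ k))).
  apply: eq_bigr => x _; rewrite mulr_sumr e_sum.
  by apply: eq_bigr => j _; rewrite mulrA.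
have S0 : S 0 = p%:R.
  rewrite /S; under eq_bigr do rewrite mul0r e0.
  by rewrite sumr_const card_Fp.
have main : p%:R * (N%:R - p%:R ^+ s.-1) = \sum_(c | c != 0) \prod_j S (c * a j).
  rewrite mulrBr pN (bigD1 0) //= -exprS (prednK s0).
  under [X in X + _ - _]eq_bigr do rewrite mul0r S0.
  by rewrite prodr_const card_ord addrC addKr.
pose B : algC := sqrtC (2 * k ^ 2 * p)%:R.
have B0 : 0 <= B by rewrite sqrtC_ge0 ler0n.
have SB c : c != 0 -> `|S c| <= B.
  move=> c0; rewrite -(@ler_pXn2r _ 2) ?nnegrE //.
  by rewrite sqrtCK S_bound.
have Sp c : `|S c| <= p%:R.
  apply: le_trans (ler_norm_sum _ _ _) _.
  by under eq_bigr do rewrite e_norm; rewrite sumr_const card_Fp.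
have le1 : `|N%:R - p%:R ^+ s.-1| <= p%:R * B ^+ s.-1.
  rewrite -(ler_pM2l p0) -{1}(ger0_norm (ltW p0)) -normrM main.
  apply: le_trans (ler_norm_sum _ _ _) _.
  apply: le_trans (_ : \sum_(c : 'F_p | c != 0) p%:R * B ^+ s.-1 <= _).
    apply: ler_sum => c c0; rewrite normr_prod (bigD1 j0) //=.
    apply: ler_pM; rewrite ?normr_ge0 ?prodr_ge0 //.
    apply: le_trans (_ : \prod_(j < s | j != j0) B <= _).
      by apply: ler_prod => j jj; rewrite normr_ge0 SB // mulf_neq0 // aj.
    by rewrite prodr_const -[#|_|]/#|predC1 j0| cardC1 card_ord.
  rewrite sumr_const -[#|_|]/#|predC1 (0 : 'F_p)| cardC1 card_Fp // -[leLHS]mulr_natl.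
  by rewrite ler_wpM2r ?ler_nat ?leq_pred // mulr_ge0 ?exprn_ge0 ?(ltW p0).
apply: le_trans (_ : (p%:R * B ^+ s.-1) ^+ 2 <= _).
  by rewrite ler_pXn2r ?nnegrE ?normr_ge0 // mulr_ge0 ?exprn_ge0 ?(ltW p0).
by rewrite exprMn exprAC sqrtCK -natrX -[X in _ * X]natrX -natrM.
Qed.
End ExpSum.

(** The squared form has integers on both sides, so the estimate can leave [algC] and be used in any
    [realType]. *)
Lemma card_diag_Fp (p k s : nat) (a : 'I_s -> 'F_p) (j0 : 'I_s) :
  prime p -> (0 < k)%N -> (forall j, j != j0 -> a j != 0) ->
  ((#|[set x : {ffun 'I_s -> 'F_p} | (\sum_j a j * x j ^+ k == 0)%R]|)%:Z
    - (p ^ s.-1)%:Z) ^+ 2 <= (p ^ 2 * (2 * k ^ 2 * p) ^ s.-1)%:Z.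
Proof.
move=> pp k0 aj.
have [z zP] := C_prim_root_exists (prime_gt0 pp).
have := exp_sum_count pp k0 zP aj; set N := #|_|.
rewrite -natrX -[N%:R]/(N%:Z%:~R) -[(p ^ _)%:R]/((p ^ s.-1)%N%:Z%:~R) -rmorphB /=.
rewrite -intr_norm -rmorphXn /= -[X in _ <= X]/(((p ^ 2 * (2 * k ^ 2 * p) ^ s.-1)%N%:Z)%:~R) ler_int.
by rewrite real_normK // num_real.
Qed.

(** * Primes dividing at most one coefficient *)

(** With r = s-1 >= 5, the point count has error at most K p^(1+r/2), and at most p zeros are
    singular; divided by p^r, both are O(p^(-3/2)). *)
Lemma chi_ge_good (R : realType) (k p : nat) (a : seq int) (j0 : 'I_(size a)) :
  prime p -> (0 < k)%N -> (6 <= size a)%N -> ~~ (p %| k)%N -> chi R k p a != 0 ->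
  (forall j : 'I_(size a), j != j0 -> ~~ (p%:Z %| a`_j)%Z) ->
  1 - (Num.sqrt ((2 * k ^ 2) ^ (size a).-1)%:R + 1) / Num.sqrt p%:R ^+ 3 <= chi R k p a.
Proof.
move=> pp k0 s6 pk chi0 aj.
have s0 : (0 < size a)%N by apply: leq_trans s6.
have chp : p \in [pchar 'F_p] by exact: pchar_Fp.
apply: le_trans (chi_ge_nonsing pp pk chi0 s0); set M := #|_|.
have aj' (j : 'I_(size a)) : j != j0 -> (a`_j)%:~R != 0 :> 'F_p.
  by move=> /aj; rewrite (dvdz_pcharf chp).
have := card_diag_Fp pp k0 aj'; set N := #|_| => HN.
(* Singular zeros lie in Z: away from [j0] the coefficients are units, so those coordinates vanish
   and only one is free. *)
pose Z := [set x : {ffun 'I_(size a) -> 'F_p} | [forall j : 'I_(size a), (j != j0) ==> (x j == 0)]].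
have NM : (N <= M + p)%N.
  have ZP : (#|Z| <= p)%N.
    have inj : {in Z &, injective (fun x : {ffun 'I_(size a) -> 'F_p} => x j0)}.
      move=> x y; rewrite !inE => /forallP xZ /forallP yZ xy; apply/ffunP => j.
      have [-> //|jj] := eqVneq j j0.
      by have := xZ j; have := yZ j; rewrite jj /= => /eqP -> /eqP ->.
    by rewrite -(card_in_imset inj) -[X in (_ <= X)%N](card_Fp pp) max_card.
  apply: leq_trans (leq_add (leqnn M) ZP).
  apply: leq_trans (leq_card_setU _ _); apply: subset_leq_card.
  apply/fintype.subsetP => x; rewrite inE => x0; rewrite finset.in_setU [in X in X || _]inE x0 /=.
  case: existsP => //= no; rewrite inE; apply/forallP => j; apply/implyP => jj.
  apply/negPn/negP => xj; apply: no; exists j.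
  by rewrite mulf_neq0 // aj'.
set r := (size a).-1 in HN *.
have r5 : (5 <= r)%N by rewrite /r -ltnS (prednK s0).
(* Half-integral powers of p become integral powers of q. *)
set q : R := Num.sqrt p%:R.
have qq : p%:R = q ^+ 2 by rewrite sqr_sqrtr.
have q1 : 1 <= q by rewrite -[leLHS]sqrtr1 ler_wsqrtr // ler1n prime_gt0.
have q0 : 0 < q by apply: lt_le_trans q1.
set K : R := Num.sqrt ((2 * k ^ 2) ^ r)%:R.
have K0 : 0 <= K by apply: sqrtr_ge0.
have KK : K ^+ 2 = ((2 * k ^ 2) ^ r)%:R by rewrite sqr_sqrtr.
have lower : q ^+ 2 ^+ r - q ^+ 2 * (K * q ^+ r) <= N%:R.
  have : (N%:R - q ^+ 2 ^+ r) ^+ 2 <= (q ^+ 2 * (K * q ^+ r)) ^+ 2.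
    have -> : N%:R - q ^+ 2 ^+ r = (N%:Z - (p ^ r)%:Z)%:~R.
      by rewrite rmorphB /= -qq -natrX.
    have -> : (q ^+ 2 * (K * q ^+ r)) ^+ 2 = (p ^ 2 * (2 * k ^ 2 * p) ^ r)%N%:Z%:~R.
      rewrite -[RHS]/((_ * _)%N%:R) expnMn natrM [in RHS]natrM -KK !natrX qq.
      by rewrite [LHS]exprMn [X in _ * X]exprMn -!exprM (mulnC r).
    by rewrite -rmorphXn ler_int.
  set X := N%:R - _; set Y := q ^+ 2 * _ => XY.
  have Y0 : 0 <= Y by rewrite !mulr_ge0 ?exprn_ge0 // ltW.
  suff : - Y <= X by rewrite /X; lra.
  by nra.
have M1 : q ^+ 2 ^+ r - q ^+ 2 * (K * q ^+ r) - q ^+ 2 <= M%:R.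
  rewrite lerBlDr; apply: le_trans lower _.
  by rewrite -qq -natrD ler_nat.
have P : 0 < q ^+ 2 ^+ r by rewrite !exprn_gt0.
rewrite qq ler_pdivlMr //; apply: le_trans M1.
have e3 : q ^+ 2 ^+ r = q ^+ 3 * (q ^+ (r - 5) * q ^+ 2 * q ^+ r).
  by rewrite -exprM -!exprD; congr (_ ^+ _); move: r5; clear; lia.
rewrite mulrBl mul1r -addrA lerD2l lerNl opprD !opprK {1}e3.
rewrite -[leRHS]mulrA mulKf ?expf_neq0 ?gt_eqF // mulrDl mul1r.
have l1 : 1 <= q ^+ (r - 5) by rewrite exprn_ege1.
have l2 : 1 <= q ^+ r by rewrite exprn_ege1.
have h2 : 0 <= q ^+ 2 by rewrite exprn_ge0 // ltW.
have h3 : 0 <= q ^+ r by rewrite exprn_ge0 // ltW.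
apply: lerD.
  rewrite [leLHS]mulrCA ler_wpM2l // -[leLHS]mul1r mulrA ler_wpM2r //.
  by rewrite mul1r -[leLHS]mul1r ler_wpM2r.
rewrite mulrAC -[leLHS]mul1r ler_wpM2r // -[leLHS]mulr1 ler_pM //.
Qed.

(** Telescoping: with x = sqrt n and y = sqrt(n+1), 2/x - 2/y = 2/(xy(x+y)) >= 1/y^3. *)
Lemma sum_sqrt3_le (R : realType) (P0 m : nat) : (0 < P0)%N ->
  \sum_(n < P0.+1 + m | (P0 < n)%N) (Num.sqrt n%:R ^+ 3)^-1
    <= 2 / Num.sqrt P0%:R - 2 / Num.sqrt (P0 + m)%:R :> R.
Proof.
move=> P00; elim: m => [|m IH].
  rewrite !addn0 subrr big1 // => n; rewrite ltnNge -ltnS ltn_ord //.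
rewrite addnS big_mkcond big_ord_recr /= -big_mkcond /=.
rewrite (leq_trans (ltnSn _) (leq_addr _ _)).
apply: le_trans (lerD IH (lexx _)) _.
rewrite addSn addnS -addrA lerD2l.
set n := (P0 + m)%N.
have n0 : (0 < n)%N by rewrite addn_gt0 P00.
set x : R := Num.sqrt n%:R; set y : R := Num.sqrt n.+1%:R.
have x0 : 0 < x by rewrite sqrtr_gt0 ltr0n.
have y0 : 0 < y by rewrite sqrtr_gt0 ltr0n.
have xy : x <= y by rewrite ler_wsqrtr // ler_nat.
have e : y ^+ 2 = x ^+ 2 + 1 by rewrite !sqr_sqrtr // natr1.
rewrite addrC lerBlDr addrC.
have -> : 2 / x - 2 / y = 2 / (x * y * (x + y)).
  have h : (y - x) * (x + y) = 1 by rewrite [x + y]addrC -subr_sqr e addrC addKr.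
  transitivity (2 * ((y - x) * (x + y)) / (x * y * (x + y))); last by rewrite h mulr1.
  by field; rewrite !gt_eqF // addr_gt0.
rewrite ler_pdivlMr ?mulr_gt0 ?addr_gt0 // mulrC ler_pdivrMr ?exprn_gt0 //.
have : x * y <= y * y by rewrite ler_wpM2r // ltW.
have : x + y <= 2 * y by lra.
move=> h1 h2; apply: le_trans (ler_pM _ _ h2 h1) _; rewrite ?mulr_ge0 ?addr_ge0 ?(ltW x0) ?(ltW y0) //.
by rewrite (_ : y * y * (2 * y) = 2 * y ^+ 3) //; ring.
Qed.

(** Weierstrass's inequality; the induction must also carry that the product lies in [0, 1]. *)
Lemma prod_1sub_ge (R : realType) (I : Type) (r : seq I) (P : pred I) (u : I -> R) :
  (forall i, P i -> 0 <= u i <= 1) ->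
  1 - \sum_(i <- r | P i) u i <= \prod_(i <- r | P i) (1 - u i).
Proof.
move=> u01; have : 0 <= \prod_(i <- r | P i) (1 - u i) <= 1 /\
  1 - \sum_(i <- r | P i) u i <= \prod_(i <- r | P i) (1 - u i); last by case.
apply: (big_rec2 (fun x y => 0 <= y <= 1 /\ 1 - x <= y)).
  by rewrite ler01 lexx subr0.
move=> i x y /u01 /andP[u0 u1] [/andP[y0 y1] xy]; split; last nra.
by apply/andP; split; nra.
Qed.

(** The tail sum of C p^(-3/2) is at most 2C / sqrt P0 <= 1/2. The second part allows these factors
    to be multiplied in at bad primes too. *)
Lemma good_product (R : realType) (C : R) (P0 N : nat) (P : pred nat) :
  0 <= C -> (0 < P0)%N -> 4 * C <= Num.sqrt P0%:R ->
  2^-1 <= \prod_(p < N | P p && (P0 < p)%N) (1 - C / Num.sqrt p%:R ^+ 3) /\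
  (forall p, (P0 < p)%N -> 0 <= 1 - C / Num.sqrt p%:R ^+ 3 <= 1).
Proof.
move=> C0 P00 CP.
have sP : 0 < Num.sqrt P0%:R :> R by rewrite sqrtr_gt0 ltr0n.
have u01 p : (P0 < p)%N -> 0 <= C / Num.sqrt p%:R ^+ 3 <= 1.
  move=> Pp.
  have s1 : 1 <= Num.sqrt p%:R :> R.
    by rewrite -[leLHS]sqrtr1 ler_wsqrtr // ler1n (leq_trans _ Pp).
  rewrite divr_ge0 ?exprn_ge0 //=.
  rewrite ler_pdivrMr ?exprn_gt0 ?(lt_le_trans ltr01) // mul1r.
  have : C <= Num.sqrt p%:R.
    apply: le_trans (_ : 4 * C <= _); first by lra.
    by apply: le_trans CP _; rewrite ler_wsqrtr // ler_nat ltnW.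
  move=> /le_trans; apply; rewrite exprS -[leLHS]mulr1 ler_wpM2l //.
  by rewrite exprn_ege1.
split; last by move=> p /u01 /andP[h1 h2]; rewrite subr_ge0 h2 lerBlDr lerDl.
apply: le_trans (prod_1sub_ge _ _); last by move=> p /andP[_ /u01].
rewrite lerBrDl -lerBrDr (_ : 1 - 2^-1 = 2^-1); last by lra.
apply: le_trans (_ : \sum_(p < P0.+1 + N | (P0 < p)%N) C / Num.sqrt p%:R ^+ 3 <= _).
  rewrite big_mkcond /= [leRHS]big_mkcond /= addnC big_split_ord /=.
  apply: le_trans (_ : \sum_(i < N) (if (P0 < i)%N then C / Num.sqrt i%:R ^+ 3 else 0) <= _).
    apply: ler_sum => i _; case: (P i) => //=; case: ifP => // /u01 /andP[]//.
  by rewrite lerDl sumr_ge0 // => i _; case: ifP => // /u01 /andP[].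
rewrite -mulr_sumr; apply: le_trans (ler_wpM2l C0 (sum_sqrt3_le _ N P00)) _.
apply: le_trans (_ : C * (2 / Num.sqrt P0%:R) <= _).
  by rewrite ler_wpM2l // lerBlDr lerDl divr_ge0.
rewrite mulrA ler_pdivrMr //; lra.
Qed.

(** * Bad primes *)

Section PrimePowerProducts.
Local Open Scope nat_scope.

Lemma prod_prime_pow_dvd (P : pred nat) (e : nat -> nat) (n N : nat) : 0 < n ->
  (forall p, P p -> prime p /\ e p <= logn p n) ->
  \prod_(p < N | P p) p ^ e p %| n.
Proof.
move=> n0 Pe; elim: N => [|N IH]; first by rewrite big_ord0 dvd1n.
rewrite big_mkcond big_ord_recr /= -big_mkcond /=.
case: (boolP (P N)) => [PN|_]; last by rewrite muln1.
have [Np Ne] := Pe N PN.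
rewrite Gauss_dvd ?IH ?pfactor_dvdn //.
apply: (big_ind (coprime^~ (N ^ e N))) => [|x y cx cy|i Pi]; rewrite ?coprime1n ?coprimeMl ?cx //.
apply: coprimeXl; apply: coprimeXr; have [ip _] := Pe i Pi.
by rewrite prime_coprime // dvdn_prime2 // neq_ltn ltn_ord.
Qed.

Lemma prod_prime_pow_le (P : pred nat) (e : nat -> nat) (n N : nat) : 0 < n ->
  (forall p, P p -> prime p /\ e p <= logn p n) ->
  \prod_(p < N | P p) p ^ e p <= n.
Proof. by move=> n0 Pe; apply: dvdn_leq (prod_prime_pow_dvd _ n0 Pe). Qed.

Lemma prod_pow_const (I : finType) (P : pred I) (f : I -> nat) (m : nat) :
  \prod_(i | P i) f i ^ m = (\prod_(i | P i) f i) ^ m.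
Proof. by rewrite (big_morph (fun x => x ^ m) (fun x y => expnMn x y m) (exp1n m)). Qed.

Lemma logn_prod (I : Type) (r : seq I) (P : pred I) (f : I -> nat) (p : nat) :
  (forall i, 0 < f i) ->
  logn p (\prod_(i <- r | P i) f i) = \sum_(i <- r | P i) logn p (f i).
Proof.
move=> f0.
suff: logn p (\prod_(i <- r | P i) f i) = \sum_(i <- r | P i) logn p (f i) /\
  0 < \prod_(i <- r | P i) f i by case.
apply: (big_rec2 (fun x y => logn p x = y /\ 0 < x)) => [|i x y Pi [<- x0]].
  by rewrite logn1.
by rewrite lognM // muln_gt0 f0.
Qed.

(** Small primes count as bad because there the bound of [chi_ge_good] may be negative, or p may
    divide k. *)
Definition bad_prime (P0 s : nat) (b : 'I_s -> nat) (p : nat) : bool :=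
  prime p && ((p <= P0) || [exists i : 'I_s, exists j : 'I_s, [&& i != j, p %| b i & p %| b j]]).

(** With v_j the valuation of b_j at p, 2 v_j <= 2 + 4 floor(v_j/2). So the product is at most the
    (2s+1)-th power of the product of the bad primes, times the square of the k-part, times fourth
    powers of numbers whose squares divide the b_j. *)
Lemma prod_bad_prime_le (P0 k s T N : nat) (b : 'I_s -> nat) :
  0 < k -> 0 < s -> (forall j, 0 < b j) ->
  (forall i j, i != j -> gcdn (b i) (b j) <= T) ->
  (forall j d, d ^ 2 %| b j -> d <= T) ->
  \prod_(p < N | bad_prime P0 b p) p ^ (logn p (k * \prod_j b j)).*2.+1
    <= P0`! ^ (s.*2.+1) * k ^ 2 * T ^ (s ^ 2 * s.*2.+1 + 4 * s).
Proof.
move=> k0 s0 b0 gT dT.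
(* Every bad prime divides D: through P0! if it is at most P0, otherwise through a gcd. *)
pose D := P0`! * \prod_(i < s) \prod_(j < s) (if i != j then gcdn (b i) (b j) else 1).
have g0 i j : 0 < if i != j then gcdn (b i) (b j) else 1.
  by case: ifP => // _; rewrite gcdn_gt0 b0.
have D0 : 0 < D.
  by rewrite muln_gt0 fact_gt0 prodn_gt0 // => i; rewrite prodn_gt0.
have DT : D <= P0`! * T ^ (s ^ 2).
  rewrite leq_mul2l; apply/orP; right.
  have T1 : 0 < T.
    by apply: leq_trans (dT (Ordinal s0) 1 _); rewrite // dvd1n.
  apply: leq_trans (_ : \prod_(i < s) \prod_(j < s) T <= _).
    apply: leq_prod => i _; apply: leq_prod => j _; case: ifP => // ij; exact: gT.
  by rewrite !prod_nat_const !card_ord -expnM mulnn.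
pose rad := \prod_(p < N | bad_prime P0 b p) p.
have radD : rad <= D.
  rewrite /rad; under eq_bigr do rewrite -[nat_of_ord _]expn1.
  apply: (@prod_prime_pow_le _ (fun=> 1)) => // p /andP[pp bp]; split=> //.
  rewrite logn_gt0 mem_primes pp D0 /=.
  case/orP: bp => [pP|/existsP [i /existsP [j /and3P [ij pi pj]]]].
    by rewrite dvdn_mulr // dvdn_fact // prime_gt0.
  apply: dvdn_mull; rewrite (bigD1 i) //=; apply: dvdn_mulr.
  by rewrite (bigD1 j) //= ij; apply: dvdn_mulr; rewrite dvdn_gcd pi.
pose kp := \prod_(p < N | bad_prime P0 b p) p ^ logn p k.
have kpk : kp <= k.
  by apply: (@prod_prime_pow_le _ (logn^~ k)) => // p /andP[].
pose sq j := \prod_(p < N | bad_prime P0 b p) p ^ (logn p (b j))./2.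
have sqT j : sq j <= T.
  apply: (dT j); rewrite /sq -prod_pow_const.
  under eq_bigr do rewrite -expnM.
  apply: (@prod_prime_pow_dvd _ (fun p => (logn p (b j))./2 * 2)) => // p /andP[pp _].
  by split=> //; rewrite muln2 -{2}(odd_double_half (logn p (b j))) leq_addl.
have main : \prod_(p < N | bad_prime P0 b p) p ^ (logn p (k * \prod_j b j)).*2.+1
   <= rad ^ (s.*2.+1) * kp ^ 2 * \prod_j sq j ^ 4.
  have -> : \prod_j sq j ^ 4 =
     \prod_(p < N | bad_prime P0 b p) \prod_j p ^ ((logn p (b j))./2 * 4).
    rewrite exchange_big; apply: eq_bigr => j _; rewrite /sq -prod_pow_const.
    by apply: eq_bigr => p _; rewrite expnM.
  rewrite /rad /kp -!prod_pow_const -!big_split /=; apply: leq_prod => p /andP[pp _].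
  have p0 := prime_gt0 pp.
  rewrite -expnM -expn_sum -!expnD leq_pexp2l // lognM // ?prodn_gt0 //.
  rewrite logn_prod //.
  have : (\sum_(j < s) logn p (b j)).*2 <= s.*2 + \sum_(j < s) (logn p (b j))./2 * 4.
    have -> : s.*2 = \sum_(j < s) 2 by rewrite sum_nat_const card_ord muln2.
    rewrite -muln2 big_distrl -big_split /=; apply: leq_sum => j _.
    by have := odd_double_half (logn p (b j)); case: odd; lia.
  move: (\sum_(j < s) logn p (b j)) (\sum_(j < s) _ * 4) => S Q; lia.
apply: leq_trans main _.
apply: leq_trans (_ : (P0`! * T ^ (s ^ 2)) ^ s.*2.+1 * k ^ 2 * (T ^ 4) ^ s <= _).
  apply: leq_mul; first apply: leq_mul; rewrite ?leq_exp2r //.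
    exact: leq_trans DT.
  apply: leq_trans (_ : \prod_(j < s) T ^ 4 <= _).
    by apply: leq_prod => j _; rewrite leq_exp2r.
  by rewrite prod_nat_const card_ord.
rewrite expnMn -!expnM expnD -!mulnA; apply: leq_mul => //.
by apply: eq_leq; rewrite mulnCA; congr (_ * _); exact: mulnCA.
Qed.

End PrimePowerProducts.

(** * Lower bound for the singular series *)

Lemma chi_neq0 (R : realType) (k : nat) (a : seq int) : singser R k a != 0 ->
  forall p, prime p -> chi R k p a != 0.
Proof.
move=> S0 p pp; apply: contra_neq S0 => c0.
(* One zero factor makes all partial products beyond p vanish. *)
apply: (@cvg_lim R) => //; apply: cvg_near_cst.
exists p.+1 => // N /= pN.
by rewrite (bigD1 (Ordinal pN)) //= c0 mul0r.
Qed.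

Lemma chi_ge0 (R : realType) (k p : nat) (a : seq int) : 0 <= chi R k p a.
Proof.
have [->//|c0] := eqVneq (chi R k p a) 0.
apply: limr_ge; first exact: limn_neq0_cvg.
by apply: nearW => h; rewrite mulr_ge0 // exprz_ge0.
Qed.

Lemma logn_coef_bound (k p : nat) (a : seq int) (j : 'I_(size a)) :
  prime p -> (0 < k)%N -> all (fun x => x != 0) a ->
  ~~ (p%:Z ^+ (logn p (k * \prod_(j < size a) `|(a`_j)%R|)).+1 %| k%:Z * a`_j)%Z.
Proof.
move=> pp k0 /allP aP.
have a0 (i : 'I_(size a)) : (0 < `|(a`_i)%R|)%N by rewrite absz_gt0 aP ?mem_nth.
have n0 : (0 < k * \prod_(j < size a) `|(a`_j)%R|)%N by rewrite muln_gt0 k0 prodn_gt0.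
set n := (k * _)%N in n0 *.
rewrite dvdzE abszX abszM /=; apply: contraNN (_ : ~~ (p ^ (logn p n).+1 %| n)%N).
  move=> /dvdn_trans; apply; rewrite /n dvdn_pmul2l //.
  by rewrite (bigD1 j) //= dvdn_mulr.
by rewrite pfactor_dvdn // ltnn.
Qed.

Lemma not_bad_prime (P0 p : nat) (a : seq int) : (0 < size a)%N -> prime p ->
  ~~ bad_prime P0 (fun j : 'I_(size a) => `|(a`_j)%R|%N) p ->
  (P0 < p)%N /\ exists j0 : 'I_(size a), forall j, j != j0 -> ~~ (p%:Z %| a`_j)%Z.
Proof.
move=> s0 pp; rewrite /bad_prime pp negb_or -ltnNge => /andP[-> /existsPn no]; split=> //.
have [/existsP [i pi]|/existsPn np] := boolP [exists i : 'I_(size a), (p %| `|(a`_i)%R|)%N].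
  exists i => j ji; apply: contraNN (no i) => pj; apply/existsP; exists j.
  by move: pj; rewrite dvdzE eq_sym ji pi.
by exists (Ordinal s0) => j _; rewrite dvdzE; apply: np.
Qed.

(** The bound is proved for every partial product over p < N, with constants free of N; positivity
    of [singser] supplies convergence. *)
Lemma singser_ge (R : realType) (k s : nat) : (0 < k)%N -> (k < s)%N -> (6 <= s)%N ->
  exists (c : R) (E : nat), 0 < c /\ (0 < E)%N /\
  forall (a : seq int) (T : nat), size a = s -> all (fun x => x != 0) a ->
    (forall i j : 'I_(size a), i != j -> (gcdn `|(a`_i)%R| `|(a`_j)%R| <= T)%N) ->
    (forall (j : 'I_(size a)) d, (d ^ 2 %| `|(a`_j)%R|)%N -> (d <= T)%N) ->
    0 < singser R k a -> c / T%:R ^+ E <= singser R k a.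
Proof.
move=> k0 ks s6.
pose C : R := Num.sqrt ((2 * k ^ 2) ^ s.-1)%:R + 1.
have C0 : 0 <= C by rewrite addr_ge0 ?sqrtr_ge0.
(* The summand k makes primes beyond P0 prime to k; the other gives 4C <= sqrt P0, as [good_product]
   asks. *)
pose P0 := (k + (Num.truncn ((4 * C) ^+ 2)).+1)%N.
have P00 : (0 < P0)%N by rewrite addn_gt0 k0.
have CP : 4 * C <= Num.sqrt P0%:R.
  rewrite -[leLHS]ger0_norm ?mulr_ge0 // -sqrtr_sqr ler_wsqrtr //.
  apply: ltW; apply: lt_le_trans (truncnS_gt _) _.
  by rewrite ler_nat leq_addl.
pose C1 := (P0`! ^ (s.*2.+1) * k ^ 2)%N.
pose E := (s ^ 2 * s.*2.+1 + 4 * s)%N.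
have C10 : (0 < C1)%N by rewrite muln_gt0 !expn_gt0 fact_gt0 k0.
(* 1/2 comes from the good primes; the rest is the bound of [prod_bad_prime_le] raised to the power
   s-1. *)
exists (2^-1 / C1%:R ^+ s.-1), (E * s.-1)%N; split; last split.
- by rewrite divr_gt0 // exprn_gt0 // ltr0n.
- by rewrite muln_gt0 /E ltn_addl /=; move: s6; clear; lia.
move=> a T sa a0 gT dT S0.
have s0 : (0 < s)%N by apply: leq_trans s6.
have s1 : (0 < s.-1)%N by move: s6; clear; lia.
have sa0 : (0 < size a)%N by rewrite sa.
have T0 : (0 < T)%N by apply: (dT (Ordinal sa0) 1%N); rewrite dvd1n.
have chi0 := chi_neq0 (lt0r_neq0 S0).
apply: limr_ge; first by apply: limn_neq0_cvg; apply: lt0r_neq0 S0.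
apply: nearW => N.
pose b (j : 'I_(size a)) := `|(a`_j)%R|%N.
pose w p := (logn p (k * \prod_(j < size a) `|(a`_j)%R|))%N.
have [G2 G01] := good_product N prime C0 P00 CP.
have b0 j : (0 < b j)%N by rewrite absz_gt0; apply: (allP a0); rewrite mem_nth.
have B := @prod_bad_prime_le P0 k (size a) T N b k0 sa0 b0 gT dT.
(* The factors 1 - C p^(-3/2) run over all primes beyond P0, bad ones included: lying in [0, 1],
   they only weaken the bound there. *)
apply: le_trans (_ : (\prod_(p < N | prime p && (P0 < p)%N) (1 - C / Num.sqrt p%:R ^+ 3)) *
   (\prod_(p < N | bad_prime P0 b p) (p%:R ^+ ((w p).*2.+1 * s.-1))^-1) <= _).
  rewrite -mulrA; apply: ler_pM => //.
  rewrite prodfV -invfM lef_pV2 ?posrE; last 2 first.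
  - by rewrite mulr_gt0 // exprn_gt0 // ltr0n.
  - by apply: prodr_gt0 => p /andP[pp _]; rewrite exprn_gt0 // ltr0n prime_gt0.
  rewrite exprM -exprMn; under eq_bigr do rewrite exprM.
  rewrite prodrXl ler_pXn2r ?s1 ?nnegrE ?mulr_ge0 ?exprn_ge0 ?prodr_ge0 //.
  under eq_bigr do rewrite -natrX.
  by rewrite -natr_prod -natrX -natrM ler_nat /C1 /E -sa.
rewrite big_mkcond [X in _ * X]big_mkcond -big_split /= [leRHS]big_mkcond /=.
apply: ler_prod => p _.
have [pp|np] := boolP (prime p); last first.
  by rewrite /bad_prime (negPf np) /= mulr1 ler01 lexx.
have Gp : 0 <= (if (P0 < p)%N then 1 - C / Num.sqrt p%:R ^+ 3 else 1) <= 1.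
  by case: ifP => [/G01 //|_]; rewrite ler01 lexx.
case/andP: Gp => G0 G1.
have [bp|gp] := boolP (bad_prime P0 b p).
  have B0 : 0 <= (p%:R ^+ ((w p).*2.+1 * s.-1))^-1 :> R by rewrite invr_ge0 exprn_ge0.
  rewrite mulr_ge0 //=.
  apply: le_trans (_ : (p%:R ^+ ((w p).*2.+1 * s.-1))^-1 <= _).
    by rewrite -[leRHS]mul1r ler_wpM2r.
  rewrite -{1}sa; apply: chi_ge_bad => //; first by rewrite sa.
    by rewrite lt0r chi0 // chi_ge0.
  by move=> j; exact: logn_coef_bound.
have [Pp [j0 Hj0]] := not_bad_prime sa0 pp gp.
rewrite mulr1 G0 /= Pp /C -sa; apply: (chi_ge_good pp k0) Hj0 => //; first by rewrite sa.
  apply/negP => /dvdn_leq -/(_ k0); rewrite leqNgt => /negP; apply.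
  by apply: leq_trans Pp; rewrite ltnS leq_addr.
exact: chi0.
Qed.

(** * Counting exceptional coefficient vectors *)

Lemma count_allpairs (S T U : Type) (f : S -> T -> U) (Q : pred U) (s : seq S) (t : seq T) :
  count Q [seq f x y | x <- s, y <- t] = (\sum_(x <- s) count (fun y => Q (f x y)) t)%N.
Proof.
elim: s => [|x s IH]; first by rewrite big_nil.
by rewrite allpairs_cons count_cat count_map IH big_cons.
Qed.

Definition interval_seq (B : nat) : seq int := [seq i%:Z - B%:Z | i <- iota 0 (B + B).+1].

(** The box is a product set; letting P depend on the index allows conditions on one or two
    coordinates while the others stay free. *)
Lemma count_box (n B : nat) (P : nat -> pred int) :
  count (fun a => all (fun i => P i a`_i) (iota 0 n)) (box n B) =
  (\prod_(i < n) count (P i) (interval_seq B))%N.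
Proof.
elim: n P => [|n IH] P; first by rewrite big_ord0.
rewrite big_ord_recl -[box n.+1 B]/[seq x :: t | x <- interval_seq B, t <- box n B].
rewrite count_allpairs -(IH (fun i => P i.+1)).
rewrite -sum1_count big_distrl /= [RHS]big_mkcond /=; apply: eq_bigr => x _.
rewrite (iotaDl 1 0 n); under eq_count => t do rewrite all_map /=.
by case: (P 0%N x) => /=; rewrite ?mul1n // count_pred0.
Qed.

Lemma size_box (n B : nat) (a : seq int) : a \in box n B -> size a = n.
Proof.
elim: n a => [|n IH] a; first by rewrite inE => /eqP ->.
rewrite -[box n.+1 B]/[seq x :: t | x <- interval_seq B, t <- box n B].
by case/allpairsP => -[x t] /= [_ /IH <- ->].
Qed.

(** With 0 left out, there are floor(B/d) multiples of each sign, so no additive constant enters the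
    later sum over d. *)
Lemma count_dvd_interval (B d : nat) : (0 < d)%N ->
  (count (fun x : int => (x != 0%R) && (d%:Z %| x)%Z) (interval_seq B) <= 2 * (B %/ d))%N.
Proof.
move=> d0; rewrite count_map -sum1_count big_mkcond -[(B + B).+1]subn0 -/(index_iota 0 _).
rewrite (@big_cat_nat _ _ _ B) //=; last first.
  by rewrite leqW // leq_addr.
rewrite [X in (_ + X)%N]big_ltn ?ltnS ?leq_addr // subrr eqxx add0n.
have -> : (2 * (B %/ d) = B %/ d + B %/ d)%N by rewrite mul2n addnn.
rewrite divn_count_dvd; apply: leq_add.
  rewrite big_nat_rev /= add0n big_add1 /= !big_mkord; apply: leq_sum => i _.
  have -> : (B - i.+1)%N%:Z - B%:Z = - (i.+1)%:Z.
    by rewrite -subzn // addrAC subrr add0r.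
  by rewrite dvdzE abszN /=; case: ifP => // /andP[_ ->].
rewrite -{1}[B.+1]add0n big_addn (_ : (B + B).+1 - B.+1 = B)%N; last by rewrite subSS addKn.
rewrite big_add1 /= !big_mkord; apply: leq_sum => i _.
have -> : (i + B.+1)%N%:Z - B%:Z = (i.+1)%:Z.
  by rewrite addnS -addSn PoszD addrK.
by rewrite dvdzE /=; case: ifP => // /andP[_ ->].
Qed.

Lemma sum_inv_sqr_le (R : realType) (T : R) (N : nat) : 0 < T ->
  \sum_(d < N | T < d%:R) (d%:R ^+ 2)^-1 <= 2 / T.
Proof.
move=> T0.
(* This sharper form carries the induction, telescoping through 1/N^2 <= 2/N - 2/(N+1). *)
suff: \sum_(d < N | T < d%:R) (d%:R ^+ 2)^-1 <= if T < N%:R then 2 / T - 2 / N%:R else 0.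
  move=> /le_trans; apply; case: ifP => _; last by rewrite divr_ge0 // ltW.
  by rewrite lerBlDr lerDl divr_ge0.
elim: N => [|N IH]; first by rewrite big_ord0 ltNge (ltW T0).
rewrite big_mkcond big_ord_recr /= -big_mkcond /=.
have [TN|NT] := ltP T N%:R; rewrite ?TN in IH *; last first.
  rewrite addr0; rewrite ltNge NT /= in IH.
  apply: le_trans IH _; case: ifP => // TS; rewrite subr_ge0 ler_wpM2l //.
  by rewrite lef_pV2 ?posrE // ?(lt_trans T0 TS) // ltW.
have N0 : 0 < N%:R :> R by apply: lt_trans TN.
rewrite (lt_trans TN) ?ltr_nat //.
apply: le_trans (lerD IH (lexx _)) _.
rewrite -addrA lerD2l -(natr1 N); set x : R := N%:R in N0 *.
have x1 : 1 <= x by rewrite ler1n -(ltr0n R).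
rewrite addrC lerBlDr [leRHS]addrC.
have -> : 2 / x - 2 / (x + 1) = 2 / (x * (x + 1)) by field; rewrite !gt_eqF // addr_gt0.
rewrite ler_pdivlMr ?mulr_gt0 ?addr_gt0 // mulrC ler_pdivrMr ?exprn_gt0 //.
nra.
Qed.

Lemma count_has_le (I : finType) (U : Type) (P : pred I) (Q : I -> pred U) (l : seq U) :
  (count (fun a => [exists (i | P i), Q i a]) l <= \sum_(i | P i) count (Q i) l)%N.
Proof.
elim: l => [|a l IH] /=; first by [].
rewrite big_split /=; apply: leq_add => //.
case: existsP => //= -[i /andP[Pi Qi]].
by rewrite (bigD1 i) //= Qi.
Qed.

Lemma leq_count_in (U : eqType) (P Q : pred U) (l : seq U) :
  (forall a, a \in l -> P a -> Q a) -> (count P l <= count Q l)%N.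
Proof.
move=> PQ; have -> : count P l = count (predI P Q) l.
  by apply: eq_in_count => a al /=; case: (boolP (P a)) => //= /(PQ _ al) ->.
by apply: sub_count => a /andP[].
Qed.

(** Bounding d by B makes the search finite; nothing is lost for nonzero entries of size at most B,
    whose divisors do not exceed B. *)
Definition exceptional (R : realType) (s B : nat) (T : R) (a : seq int) : bool :=
  all (fun x => x != 0) a &&
  [exists d : 'I_B.+1, (T < d%:R) &&
    ([exists (ij : 'I_s * 'I_s | ij.1 != ij.2), (d%:Z %| a`_ij.1)%Z && (d%:Z %| a`_ij.2)%Z] ||
     [exists i : 'I_s, (d%:Z ^+ 2 %| a`_i)%Z])].

(** For fixed d > T, the vectors with d dividing two given entries, or d^2 dividing a given one,
    number at most (3A)^s / d^2. There are at most s^2 + s choices of positions, and the sum over d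
    gives 2/T. *)
Lemma count_exceptional (R : realType) (s : nat) (A T : R) : 1 <= A -> 0 < T ->
  (count (exceptional s (Num.truncn A) T) (box s (Num.truncn A)))%:R
    <= (s ^ 2 + s)%:R * (3 * A) ^+ s * (2 / T).
Proof.
move=> A1 T0; set B := Num.truncn A.
have A0 : 0 <= A by apply: le_trans A1.
have BA : B%:R <= A by rewrite truncn_le.
have B3 : (B + B).+1%:R <= 3 * A by rewrite -natr1 natrD; lra.
have szI : size (interval_seq B) = (B + B).+1 by rewrite size_map size_iota.
pose D (d : nat) : pred int := fun x => (x != 0) && (d%:Z %| x)%Z.
have cD d : (0 < d)%N -> (count (D d) (interval_seq B))%:R <= (3 * A) / d%:R.
  move=> d0; apply: le_trans (_ : (2 * (B %/ d))%:R <= _).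
    by rewrite ler_nat count_dvd_interval.
  rewrite ler_pdivlMr ?ltr0n // -natrM -mulnA.
  apply: le_trans (_ : (2 * B)%:R <= _); first by rewrite ler_nat leq_mul2l leq_divM orbT.
  by rewrite natrM; lra.
have cle (Q : pred int) : (count Q (interval_seq B))%:R <= 3 * A.
  by apply: le_trans B3; rewrite ler_nat -szI count_size.
have nz a i : a \in box s B -> all (fun x => x != 0) a -> (i < s)%N -> a`_i != 0.
  by move=> /size_box sa /allP aP il; apply: aP; rewrite mem_nth // sa.
have cP (P : nat -> pred int) (u : 'I_s -> R) :
    (forall l : 'I_s, (count (P l) (interval_seq B))%:R <= 3 * A * u l) ->
    (count (fun a => all (fun l => P l a`_l) (iota 0 s)) (box s B))%:R
      <= (3 * A) ^+ s * \prod_l u l.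
  move=> Pu; rewrite count_box natr_prod -[X in _ ^+ X]card_ord -prodr_const -big_split /=.
  by apply: ler_prod => l _; rewrite ler0n Pu.
pose Q2 d (ij : 'I_s * 'I_s) (a : seq int) :=
  all (fun x => x != 0) a && ((d%:Z %| a`_ij.1)%Z && (d%:Z %| a`_ij.2)%Z).
pose Q1 d (i : 'I_s) (a : seq int) := all (fun x => x != 0) a && (d%:Z ^+ 2 %| a`_i)%Z.
have c2 (d : nat) (ij : 'I_s * 'I_s) : (0 < d)%N -> ij.1 != ij.2 ->
    (count (Q2 d ij) (box s B))%:R <= (3 * A) ^+ s * (d%:R ^+ 2)^-1.
  case: ij => i j d0 /= ij.
  pose P (l : nat) : pred int := if (l == i) || (l == j) then D d else xpredT.
  apply: le_trans (_ : (count (fun a => all (fun l => P l a`_l) (iota 0 s)) (box s B))%:R <= _).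
    rewrite ler_nat; apply: leq_count_in => a aB /andP[a0 /andP[/= ai aj]].
    apply/allP => l; rewrite mem_iota /= add0n => ls; rewrite /P.
    case: ifP => // /orP[] /eqP ->; rewrite /D ?ai ?aj andbT; exact: nz.
  pose u (l : 'I_s) : R := if (l == i) || (l == j) then d%:R^-1 else 1.
  apply: le_trans (@cP P u _) _.
    move=> l; rewrite /P -[X in if X then D d else _]/((l == i) || (l == j)) /u.
    case: ifP => _; first exact: cD.
    by rewrite mulr1 cle.
  rewrite (bigD1 i) //= (bigD1 j) 1?eq_sym //= big1 ?mulr1; last first.
    by move=> l /andP[/negPf li /negPf lj]; rewrite /u li lj.
  by rewrite /u !eqxx orbT /= -invfM expr2.
have c1 (d : nat) (i : 'I_s) : (0 < d)%N ->
    (count (Q1 d i) (box s B))%:R <= (3 * A) ^+ s * (d%:R ^+ 2)^-1.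
  move=> d0; pose P (l : nat) : pred int := if l == i then D (d ^ 2)%N else xpredT.
  apply: le_trans (_ : (count (fun a => all (fun l => P l a`_l) (iota 0 s)) (box s B))%:R <= _).
    rewrite ler_nat; apply: leq_count_in => a aB /andP[a0 ai].
    apply/allP => l; rewrite mem_iota /= add0n => ls; rewrite /P.
    case: ifP => // /eqP ->; by rewrite /D nz.
  pose u (l : 'I_s) : R := if l == i then (d%:R ^+ 2)^-1 else 1.
  apply: le_trans (@cP P u _) _.
    move=> l; rewrite /P -[X in if X then D (d ^ 2)%N else _]/(l == i) /u.
    case: ifP => _; last by rewrite mulr1 cle.
    by rewrite -natrX cD // expn_gt0 d0.
  rewrite (bigD1 i) //= big1 ?mulr1; first by rewrite /u eqxx.
  by move=> l /negPf li; rewrite /u li.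
pose Q d a := [exists (ij : 'I_s * 'I_s | ij.1 != ij.2), Q2 d ij a] ||
  [exists (i : 'I_s | true), Q1 d i a].
have cQ (d : nat) : T < d%:R -> (count (Q d) (box s B))%:R
    <= (s ^ 2 + s)%:R * (3 * A) ^+ s * (d%:R ^+ 2)^-1.
  move=> Td; have d0 : (0 < d)%N by rewrite -(ltr0n R); apply: lt_trans Td.
  set Y : R := (3 * A) ^+ s * (d%:R ^+ 2)^-1.
  have Y0 : 0 <= Y by rewrite mulr_ge0 ?exprn_ge0 ?mulr_ge0 // invr_ge0 exprn_ge0.
  apply: le_trans (_ : (\sum_(ij : 'I_s * 'I_s | ij.1 != ij.2) count (Q2 d ij) (box s B)
     + \sum_(i < s | true) count (Q1 d i) (box s B))%:R <= _).
    rewrite ler_nat; apply: leq_trans (leq_add (count_has_le _ _ _) (count_has_le _ _ _)).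
    rewrite -count_predUI; apply: leq_trans (leq_addr _ _).
    by apply: sub_count.
  rewrite natrD !natr_sum -mulrA -/Y natrD mulrDl; apply: lerD.
    apply: le_trans (_ : \sum_(ij : 'I_s * 'I_s | ij.1 != ij.2) Y <= _).
      by apply: ler_sum => ij /c2; apply.
    apply: le_trans (_ : \sum_(ij : 'I_s * 'I_s) Y <= _).
      by rewrite big_mkcond; apply: ler_sum => ij _; case: ifP.
    by rewrite sumr_const card_prod !card_ord mulnn mulr_natl.
  apply: le_trans (_ : \sum_(i < s) Y <= _); first by apply: ler_sum => i _; exact: c1.
  by rewrite sumr_const card_ord mulr_natl.
apply: le_trans (_ : (\sum_(d < B.+1 | T < d%:R) count (Q d) (box s B))%:R <= _).
  rewrite ler_nat; apply: leq_trans (count_has_le _ _ _); apply: sub_count => a.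
  case/andP=> a0 /existsP [d /andP[Td H]]; apply/existsP; exists d; rewrite Td /=.
  case/orP: H => /existsP [i Hi]; apply/orP; [left|right]; apply/existsP; exists i.
    by case/andP: Hi => -> Hi; rewrite /Q2 a0.
  by rewrite /Q1 a0.
rewrite natr_sum; apply: le_trans (_ : \sum_(d < B.+1 | T < d%:R)
   (s ^ 2 + s)%:R * (3 * A) ^+ s * (d%:R ^+ 2)^-1 <= _).
  by apply: ler_sum => d; exact: cQ.
by rewrite -mulr_sumr ler_wpM2l ?sum_inv_sqr_le // mulr_ge0 // exprn_ge0 // mulr_ge0.
Qed.

(** * Choice of the threshold and conclusion *)

Unset Implicit Arguments.

Theorem theorem1p2 (R : realType) (k s : nat) (eta : R) :
  (3 <= k)%N -> (k + 3 <= s)%N -> 0 < eta ->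
  exists gamma : R, 0 < gamma /\
    exists C : R, forall A : R, 1 <= A ->
      (bad_count k s eta A)%:R <= C * A `^ (s%:R - gamma).
Proof.
move=> k3 ks eta0.
have k0 : (0 < k)%N by apply: leq_trans k3.
have ks' : (k < s)%N by move: ks; clear; lia.
have s6 : (6 <= s)%N by move: ks k3; clear; lia.
have [c [E [c0 [E0 H]]]] := @singser_ge R k s k0 ks' s6.
have ER : 0 < E%:R :> R by rewrite ltr0n.
(* Exceptional vectors number O(A^s / T), and T will be a constant times A^(eta/E). *)
exists (eta / E%:R); split; first by rewrite divr_gt0.
exists ((s ^ 2 + s)%:R * 3 ^+ s * 2 / c `^ E%:R^-1) => A A1.
have A0 : 0 < A by apply: lt_le_trans A1.
(* T is chosen so that c / T^E = A^(-eta). *)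
pose T : R := c `^ E%:R^-1 * A `^ (eta / E%:R).
have T0 : 0 < T by rewrite mulr_gt0 ?powR_gt0.
have TE : T ^+ E = c * A `^ eta.
  rewrite exprMn -!powR_mulrn ?powR_ge0 // -!powRrM mulVf ?gt_eqF // powRr1 ?ltW //.
  by rewrite divfK ?gt_eqF.
apply: le_trans (_ : (count (exceptional s (Num.truncn A) T) (box s (Num.truncn A)))%:R <= _).
  rewrite ler_nat; apply: leq_count_in => a /size_box sa /and4P[a0 aA S0 SA].
  (* A counted vector that is not exceptional would have all its pairwise gcds and square divisors
     bounded by floor(T), and [singser_ge] would contradict the smallness of its singular series. *)
  rewrite /exceptional a0 /=; apply: contraT => /existsPn no.
  have le_trunc x : x \in a -> (`|x| <= Num.truncn A)%N.
    move=> xa; rewrite truncn_ge_nat ?(ltW A0) //.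
    by have := allP aA x xa; rewrite -abszE.
  have a_nz x : x \in a -> (0 < `|x|)%N by move=> xa; rewrite absz_gt0 (allP a0).
  have am (i : 'I_(size a)) : a`_i \in a by rewrite mem_nth.
  have dB d (i : 'I_(size a)) : (d %| `|(a`_i)%R|)%N -> (d < (Num.truncn A).+1)%N.
    move=> di; rewrite ltnS; apply: leq_trans (le_trunc _ (am i)).
    by rewrite dvdn_leq // a_nz.
  have small d : (d < (Num.truncn A).+1)%N ->
     ([exists (ij : 'I_s * 'I_s | ij.1 != ij.2), (d%:Z %| a`_ij.1)%Z && (d%:Z %| a`_ij.2)%Z] ||
     [exists i : 'I_s, (d%:Z ^+ 2 %| a`_i)%Z]) -> (d <= Num.truncn T)%N.
    move=> dl ex; have := no (Ordinal dl); rewrite /= ex andbT -leNgt.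
    by rewrite truncn_ge_nat // ltW.
  have gT (i j : 'I_(size a)) : i != j -> (gcdn `|(a`_i)%R| `|(a`_j)%R| <= Num.truncn T)%N.
    move=> ij; apply: small; first by apply: (dB _ i); rewrite dvdn_gcdl.
    apply/orP; left; apply/existsP; exists (cast_ord sa i, cast_ord sa j) => /=.
    by rewrite (inj_eq (@cast_ord_inj _ _ _)) ij !dvdzE /= dvdn_gcdl dvdn_gcdr.
  have dT (j : 'I_(size a)) d : (d ^ 2 %| `|(a`_j)%R|)%N -> (d <= Num.truncn T)%N.
    move=> dj; apply: small.
      by apply: (dB _ j); apply: dvdn_trans dj; rewrite -mulnn dvdn_mulr.
    by apply/orP; right; apply/existsP; exists (cast_ord sa j); rewrite dvdzE abszX.
  have := H a _ sa a0 gT dT S0; rewrite leNgt; case/negP.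
  apply: lt_le_trans SA _.
  have s0 : (0 < size a)%N by rewrite sa (leq_trans _ s6).
  (* Taking d = 1 shows floor(T) >= 1, so that no inverse of zero occurs below. *)
  have T1 : (0 < Num.truncn T)%N by apply: (dT (Ordinal s0) 1%N); rewrite dvd1n.
  apply: le_trans (_ : c / T ^+ E <= _).
    by rewrite TE invfM mulrA mulfV ?gt_eqF // mul1r powRN.
  rewrite ler_wpM2l ?(ltW c0) // lef_pV2 ?posrE ?exprn_gt0 // ?ltr0n //.
  by rewrite ler_pXn2r ?nnegrE ?(ltW T0) // truncn_le ltW.
apply: le_trans (count_exceptional _ A1 T0) _.
rewrite le_eqVlt; apply/orP; left; apply/eqP.
rewrite powRB ?(gt_eqF A0) ?implybT // powR_mulrn ?(ltW A0) // exprMn /T invfM.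
by ring.
Qed.
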